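(* There exist a finite $y_0>0$ and a function $f_1$ on $[0,y_0]$ which solves the free-boundary problem $$-\big(|1-f^2|\,f'''\big)'+\tfrac14\, f' y=0\quad\text{for } 0<y<y_0,$$ $$f(0)=f''(0)=0,\qquad f(y_0)=1,\quad f'(y_0)=0,\quad \big(|1-f^2|f'''\big)(y_0)=0,$$ and satisfies $$f_1'(y)>0\quad\text{and}\quad f_1''(y)<0\quad\text{on }(0,y_0),\qquad\text{so that}\quad 0<f_1(y)<1 \text{ on }(0,y_0).$$
   Context: The prime denotes $d/dy$. The interface point $y_0$ is an unknown of the problem (free boundary). The function $f$ is real-valued, smooth at points where $f\neq\pm1$ (in particular up to $y=0$), and $C^1$ up to $y=y_0$; the conditions at $y=y_0$, where the equation degenerates, are understood as limits as $y\to y_0^-$. *)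

(* Defs.v *)
From Stdlib Require Import Reals.
Open Scope R_scope.

Definition closed_interval (a b : R) : R -> Prop := fun y => a <= y <= b.

(* [d n] plays the role of the n-th derivative of [f].  Derivatives are taken
   relative to a subset [D] of the line ([D_in]), so that at an end point of an
   interval they are one-sided and values of [f] outside [D] are irrelevant. *)
Definition C1_on (D : R -> Prop) (f : R -> R) (d : nat -> R -> R) : Prop :=
  forall y, D y -> D_in f (d 1%nat) D y /\ continue_in (d 1%nat) D y.

Definition smooth_on (D : R -> Prop) (f : R -> R) (d : nat -> R -> R) : Prop :=
  (forall y, D y -> d 0%nat y = f y) /\
  (forall n y, D y -> D_in (d n) (d (S n)) D y).

(* The points of [0, y0] at which the equation is not degenerate.  When [f] is
   continuous this set is relatively open in [0, y0], hence has no isolated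
   point if [0 < y0], and derivatives relative to it are unique. *)
Definition nondegenerate (y0 : R) (f : R -> R) : R -> Prop :=
  fun y => 0 <= y <= y0 /\ f y <> 1 /\ f y <> -1.

Definition flux (f : R -> R) (d : nat -> R -> R) : R -> R :=
  fun y => Rabs (1 - f y ^ 2) * d 3%nat y.

(* [d 3 y] has no meaning at [y = y0], so the flux condition there is a limit
   from the left; for [f] and [f'] the limits at [y0] agree with the values,
   by [fbp_C1]. *)
Record solves_fbp (y0 : R) (f : R -> R) (d : nat -> R -> R) : Prop := {
  fbp_C1 : C1_on (closed_interval 0 y0) f d;
  fbp_smooth : smooth_on (nondegenerate y0 f) f d;
  fbp_ode : forall y, 0 < y < y0 ->
    exists dflux : R, derivable_pt_lim (flux f d) y dflux /\
      - dflux + 1 / 4 * d 1%nat y * y = 0;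
  fbp_f_0 : f 0 = 0;
  fbp_f2_0 : d 2%nat 0 = 0;
  fbp_f_y0 : f y0 = 1;
  fbp_f1_y0 : d 1%nat y0 = 0;
  fbp_flux_y0 : limit1_in (flux f d) (fun y => 0 < y < y0) 0 y0
}.

(* Main.v *)
Require Import Defs.
From Stdlib Require Import Reals Lra Psatz.
From Coquelicot Require Import Coquelicot.
Open Scope R_scope.

(** Put [g = 1 - f] and rescale [y] so that the free boundary sits at [1].  The
    equation integrates once, from the interface, to
    [g''' = K h] with [h = (y + G / g) / (2 - g)], [G y] the integral of [g] from
    [y] to [1], and [K = y0^4 / 4].  Conversely, given [h], let [U] solve
    [U''' = h], [U''(0) = U'(1) = U(1) = 0]; then [g = U / U(0)], with
    [K = 1 / U(0)], satisfies all boundary conditions, so one needs a fixed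
    point of [h |-> (y + G / g) / (2 - g)].

    If [h >= 0] is not zero, then [U] is convex and [U / (1 - y)^2] is
    nondecreasing, whence [(1 - y)^2 <= g <= 1 - y] and
    [(1 - y) / 3 <= G / g <= (1 - y) / 2].  So the map takes values between [1/3]
    and [1/2], and on functions with these bounds it contracts the supremum norm
    by the factor [9/10].

    All derivatives exist away from the interface because the polynomials in
    [y], [G], [g], [g'], [g''], [1 / g], [1 / (2 - g)] are closed under
    differentiation. *)

(** * Monotonicity from the sign of the derivative *)

Lemma nonincreasing_of_derive (F dF : R -> R) (a b : R) :
  a <= b ->
  (forall y, a <= y <= b -> is_derive F y (dF y)) ->
  (forall y, a <= y <= b -> dF y <= 0) -> F b <= F a.
Proof.
  intros Hab HF Hd.
  destruct (MVT_gen F a b dF) as [c [Hc E]];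
    rewrite ?Rmin_left, ?Rmax_right in * by lra.
  - intros y Hy. apply HF. lra.
  - intros y Hy. apply derivable_continuous_pt. exists (dF y).
    apply is_derive_Reals, HF. lra.
  - specialize (Hd c Hc). nra.
Qed.

Lemma nondecreasing_of_derive (F dF : R -> R) (a b : R) :
  a <= b ->
  (forall y, a <= y <= b -> is_derive F y (dF y)) ->
  (forall y, a <= y <= b -> 0 <= dF y) -> F a <= F b.
Proof.
  intros Hab HF Hd.
  assert (H : - F b <= - F a); [|lra].
  apply (nonincreasing_of_derive (fun y => - F y) (fun y => - dF y)); trivial.
  - intros y Hy. apply (is_derive_opp F), HF, Hy.
  - intros y Hy. specialize (Hd y Hy). lra.
Qed.

(** * Iterated primitives of a nonnegative function *)

(** Derivatives are required on the whole line, so that they are two-sided at [0] and [1] as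
    well. *)
Record primitives (h I J U G : R -> R) : Prop := {
  pr_I : forall y, is_derive I y (h y);
  pr_J : forall y, is_derive J y (I y);
  pr_U : forall y, is_derive U y (J y);
  pr_G : forall y, is_derive G y (- U y);
  pr_I0 : I 0 = 0;
  pr_J1 : J 1 = 0;
  pr_U1 : U 1 = 0;
  pr_G1 : G 1 = 0
}.

(** The side goals of [auto_derive] are closed by the derivatives among the hypotheses; [unify]
    compares functions up to conversion, in particular up to eta. *)
Ltac derive_known :=
  auto_derive;
  [ repeat match goal with
    | |- _ /\ _ => split
    | |- True => exact Logic.I
    | H : forall y, is_derive ?g y _ |- ex_derive ?f ?x =>
        unify f g; exact (ex_intro _ _ (H x))
    end
  | repeat match goal with
    | |- context [Derive ?f ?x] =>
        match goal with
        | H : forall y, is_derive ?g y _ |- _ =>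
            unify f g; rewrite (is_derive_unique f x _ (H x))
        end
    end ].

Ltac pose_derivatives P :=
  pose proof (pr_I _ _ _ _ _ P); pose proof (pr_J _ _ _ _ _ P);
  pose proof (pr_U _ _ _ _ _ P); pose proof (pr_G _ _ _ _ _ P).

Ltac derive_with P := pose_derivatives P; derive_known.

Section Positivity.

Variables h I J U G : R -> R.
Hypothesis P : primitives h I J U G.
Hypothesis h_ge0 : forall y, 0 <= y <= 1 -> 0 <= h y.

Lemma primitive_I_ge0 y : 0 <= y <= 1 -> 0 <= I y.
Proof.
  intros Hy. rewrite <- (pr_I0 _ _ _ _ _ P).
  apply (nondecreasing_of_derive I h); [lra | |].
  - intros z _. apply P.
  - intros z Hz. apply h_ge0. lra.
Qed.

Lemma primitive_J_le0 y : 0 <= y <= 1 -> J y <= 0.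
Proof.
  intros Hy. rewrite <- (pr_J1 _ _ _ _ _ P).
  apply (nondecreasing_of_derive J I); [lra | |].
  - intros z _. apply P.
  - intros z Hz. apply primitive_I_ge0. lra.
Qed.

Lemma primitive_U_ge0 y : 0 <= y <= 1 -> 0 <= U y.
Proof.
  intros Hy. rewrite <- (pr_U1 _ _ _ _ _ P).
  apply (nonincreasing_of_derive U J); [lra | |].
  - intros z _. apply P.
  - intros z Hz. apply primitive_J_le0. lra.
Qed.

(** [U] is convex, and the left side is the value at [1] of its tangent at [y], hence at most
    [U 1 = 0]. *)
Lemma primitive_convex y : 0 <= y <= 1 -> J y * (1 - y) + U y <= 0.
Proof.
  intros Hy.
  assert (E : J 1 * (1 - 1) + U 1 = 0) by (rewrite (pr_U1 _ _ _ _ _ P); ring).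
  rewrite <- E.
  apply (nondecreasing_of_derive (fun y => J y * (1 - y) + U y)
           (fun y => I y * (1 - y))); [lra | |].
  - intros z _. derive_with P. ring.
  - intros z Hz. assert (0 <= I z) by (apply primitive_I_ge0; lra). nra.
Qed.

(** The same tangent argument for [J], which is convex because [h >= 0]. *)
Lemma primitive_I_mean y : 0 <= y <= 1 -> I y * (1 - y) + J y <= 0.
Proof.
  intros Hy.
  assert (E : I 1 * (1 - 1) + J 1 = 0) by (rewrite (pr_J1 _ _ _ _ _ P); ring).
  rewrite <- E.
  apply (nondecreasing_of_derive (fun y => I y * (1 - y) + J y)
           (fun y => h y * (1 - y))); [lra | |].
  - intros z _. derive_with P. ring.
  - intros z Hz. assert (0 <= h z) by (apply h_ge0; lra). nra.
Qed.

(** This is the derivative of [U / (1 - y)^2] up to the factor [(1 - y)^3]. It vanishes at [1] and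
    is nonincreasing by [primitive_I_mean]. *)
Lemma primitive_concave_ratio y : 0 <= y <= 1 -> 0 <= J y * (1 - y) + 2 * U y.
Proof.
  intros Hy.
  assert (E : J 1 * (1 - 1) + 2 * U 1 = 0)
    by (rewrite (pr_U1 _ _ _ _ _ P); ring).
  rewrite <- E.
  apply (nonincreasing_of_derive (fun y => J y * (1 - y) + 2 * U y)
           (fun y => I y * (1 - y) + J y)); [lra | |].
  - intros z _. derive_with P. ring.
  - intros z Hz. apply primitive_I_mean. lra.
Qed.

Lemma primitive_U_lower y : 0 <= y <= 1 -> (1 - y) ^ 2 * U 0 <= U y.
Proof.
  intros [Hy0 [Hy1 | ->]]; [| rewrite (pr_U1 _ _ _ _ _ P); lra].
  assert (H : U 0 / (1 - 0) ^ 2 <= U y / (1 - y) ^ 2).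
  { apply (nondecreasing_of_derive (fun y => U y / (1 - y) ^ 2)
             (fun y => (J y * (1 - y) + 2 * U y) / (1 - y) ^ 3)); trivial.
    - intros z Hz. derive_with P.
      + nra.
      + field. lra.
    - intros z Hz. apply Rdiv_le_0_compat.
      + apply primitive_concave_ratio. lra.
      + apply pow_lt. lra. }
  replace (U y) with ((1 - y) ^ 2 * (U y / (1 - y) ^ 2)) by (field; lra).
  apply Rmult_le_compat_l; [apply pow2_ge_0|].
  replace (U 0) with (U 0 / (1 - 0) ^ 2) by field. exact H.
Qed.

Lemma primitive_U_upper y : 0 <= y <= 1 -> U y <= (1 - y) * U 0.
Proof.
  intros [Hy0 [Hy1 | ->]]; [| rewrite (pr_U1 _ _ _ _ _ P); lra].
  assert (H : U y / (1 - y) <= U 0 / (1 - 0)).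
  { apply (nonincreasing_of_derive (fun y => U y / (1 - y))
             (fun y => (J y * (1 - y) + U y) / (1 - y) ^ 2)); trivial.
    - intros z Hz. derive_with P.
      + lra.
      + field. lra.
    - intros z Hz. assert (J z * (1 - z) + U z <= 0)
        by (apply primitive_convex; lra).
      assert (0 < / (1 - z) ^ 2) by (apply Rinv_0_lt_compat, pow_lt; lra).
      unfold Rdiv. nra. }
  replace (U y) with ((1 - y) * (U y / (1 - y))) by (field; lra).
  apply Rmult_le_compat_l; [lra|].
  replace (U 0) with (U 0 / (1 - 0)) by field. exact H.
Qed.

(** The difference of the two sides vanishes at [1], and its derivative has a sign by
    [primitive_concave_ratio]. Equality holds for [U = (1 - y)^2], and in [primitive_G_upper] for
    [U = 1 - y]. *)
Lemma primitive_G_lower y : 0 <= y <= 1 -> (1 - y) * U y <= 3 * G y.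
Proof.
  intros Hy.
  assert (H : 3 * G 1 - (1 - 1) * U 1 <= 3 * G y - (1 - y) * U y).
  { apply (nonincreasing_of_derive (fun y => 3 * G y - (1 - y) * U y)
             (fun y => - (J y * (1 - y) + 2 * U y))); [lra | |].
    - intros z _. derive_with P. ring.
    - intros z Hz. assert (0 <= J z * (1 - z) + 2 * U z)
        by (apply primitive_concave_ratio; lra). lra. }
  rewrite (pr_G1 _ _ _ _ _ P) in H. lra.
Qed.

Lemma primitive_G_upper y : 0 <= y <= 1 -> 2 * G y <= (1 - y) * U y.
Proof.
  intros Hy.
  assert (H : (1 - 1) * U 1 - 2 * G 1 <= (1 - y) * U y - 2 * G y).
  { apply (nonincreasing_of_derive (fun y => (1 - y) * U y - 2 * G y)
             (fun y => J y * (1 - y) + U y)); [lra | |].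
    - intros z _. derive_with P. ring.
    - intros z Hz. apply primitive_convex; lra. }
  rewrite (pr_G1 _ _ _ _ _ P) in H. lra.
Qed.

End Positivity.

(* [(1-y)^2 * (2+y) / 6] is [U] for [h = 1]. *)
Lemma primitives_compare h1 I1 J1 U1 G1 h2 I2 J2 U2 G2 (e : R) :
  primitives h1 I1 J1 U1 G1 -> primitives h2 I2 J2 U2 G2 ->
  (forall y, 0 <= y <= 1 -> h1 y <= h2 y + e) ->
  U1 0 <= U2 0 + e / 3 /\
  (forall y, 0 <= y <= 1 ->
     U1 y - (1 - y) ^ 2 * U1 0
       <= U2 y - (1 - y) ^ 2 * U2 0 + e * (y * (1 - y) ^ 2 / 6)).
Proof.
  intros P1 P2 Hh.
  (* By linearity these are the primitives of [h2 + e - h1 >= 0]. Positivity of [U] at [0] gives the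
     first claim and [primitive_U_lower] the second. *)
  pose (I := fun y => I2 y + e * y - I1 y).
  pose (J := fun y => J2 y + e * ((y ^ 2 - 1) / 2) - J1 y).
  pose (U := fun y => U2 y + e * ((1 - y) ^ 2 * (2 + y) / 6) - U1 y).
  pose (G := fun y => G2 y + e * ((1 - y) ^ 3 * (3 + y) / 24) - G1 y).
  assert (P : primitives (fun y => h2 y + e - h1 y) I J U G).
  { unfold I, J, U, G; split; try intros y.
    1-4: pose_derivatives P1; derive_with P2; field.
    - rewrite (pr_I0 _ _ _ _ _ P1), (pr_I0 _ _ _ _ _ P2). ring.
    - rewrite (pr_J1 _ _ _ _ _ P1), (pr_J1 _ _ _ _ _ P2). field.
    - rewrite (pr_U1 _ _ _ _ _ P1), (pr_U1 _ _ _ _ _ P2). field.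
    - rewrite (pr_G1 _ _ _ _ _ P1), (pr_G1 _ _ _ _ _ P2). field. }
  assert (Hpos : forall y, 0 <= y <= 1 -> 0 <= h2 y + e - h1 y)
    by (intros y Hy; specialize (Hh y Hy); lra).
  split.
  - pose proof (primitive_U_ge0 _ _ _ _ _ P Hpos 0) as H. unfold U in H. lra.
  - intros y Hy.
    pose proof (primitive_U_lower _ _ _ _ _ P Hpos y Hy) as H.
    unfold U in H. lra.
Qed.

(** Comparison with this solution turns constant bounds on [h] into bounds on [U]. *)
Lemma primitives_zero :
  primitives (fun _ => 0) (fun _ => 0) (fun _ => 0) (fun _ => 0) (fun _ => 0).
Proof.
  split; trivial; intros y; try apply @is_derive_const.
  evar_last; [apply @is_derive_const | unfold zero; simpl; ring].
Qed.

Lemma le_div a b c : 0 < c -> a * c <= b -> a <= b / c.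
Proof. intros Hc H. apply (Rle_div_r a b c Hc), H. Qed.

Lemma div_le a b c : 0 < c -> a <= b * c -> a / c <= b.
Proof. intros Hc H. apply (Rle_div_l a b c Hc), H. Qed.

(** * Bounds for the normalized profile *)

Section NormalizedProfile.

Variables h I J U G : R -> R.
Hypothesis P : primitives h I J U G.
Hypothesis h_bounds : forall y, 0 <= y <= 1 -> 1 / 3 <= h y <= 1 / 2.

Let h_ge0 y : 0 <= y <= 1 -> 0 <= h y.
Proof. intros Hy. specialize (h_bounds y Hy). lra. Qed.

Lemma profile_U0 : 1 / 9 <= U 0.
Proof.
  destruct (primitives_compare _ _ _ _ _ _ _ _ _ _ (- (1 / 3)) primitives_zero P)
    as [H _]; [| lra].
  intros y Hy. specialize (h_bounds y Hy). lra.
Qed.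

Lemma profile_lower y : 0 <= y <= 1 -> (1 - y) ^ 2 <= U y / U 0.
Proof.
  intros Hy. pose proof profile_U0. apply le_div; [lra|].
  exact (primitive_U_lower _ _ _ _ _ P h_ge0 y Hy).
Qed.

Lemma profile_upper y : 0 <= y <= 1 -> U y / U 0 <= 1 - y.
Proof.
  intros Hy. pose proof profile_U0. apply div_le; [lra|].
  exact (primitive_U_upper _ _ _ _ _ P h_ge0 y Hy).
Qed.

Lemma profile_lt2 y : 0 <= y <= 1 -> U y < 2 * U 0.
Proof.
  intros Hy. pose proof profile_U0.
  pose proof (primitive_U_upper _ _ _ _ _ P h_ge0 y Hy). nra.
Qed.

Lemma profile_U_pos y : 0 <= y < 1 -> 0 < U y.
Proof.
  intros Hy. pose proof profile_U0.
  pose proof (primitive_U_lower _ _ _ _ _ P h_ge0 y ltac:(lra)).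
  assert (0 < (1 - y) ^ 2) by (apply pow_lt; lra). nra.
Qed.

(** Comparing [h] with [1/2] bounds [U - (1 - y)^2 * U 0] by [y * (1 - y)^2 / 12]; dividing by
    [U 0 >= 1/9] gives the factor [3/4]. *)
Lemma profile_excess y :
  0 <= y <= 1 -> U y / U 0 - (1 - y) ^ 2 <= 3 / 4 * (y * (1 - y) ^ 2).
Proof.
  intros Hy. pose proof profile_U0.
  destruct (primitives_compare _ _ _ _ _ _ _ _ _ _ (1 / 2) P primitives_zero)
    as [_ H']; [intros z Hz; specialize (h_bounds z Hz); lra |].
  specialize (H' y Hy).
  enough (U y / U 0 <= (1 - y) ^ 2 + 3 / 4 * (y * (1 - y) ^ 2)) by lra.
  apply div_le; [lra|].
  assert (0 <= y * (1 - y) ^ 2) by (apply Rmult_le_pos; [lra | apply pow2_ge_0]).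
  nra.
Qed.

(* At [y = 1] the quotient [G / U] is [0 / 0 = 0]. *)
Lemma profile_quotient y :
  0 <= y <= 1 -> (1 - y) / 3 <= G y / U y <= (1 - y) / 2.
Proof.
  intros [Hy0 [Hy1 | ->]].
  - pose proof (profile_U_pos y (conj Hy0 Hy1)).
    pose proof (primitive_G_lower _ _ _ _ _ P h_ge0 y ltac:(lra)).
    pose proof (primitive_G_upper _ _ _ _ _ P h_ge0 y ltac:(lra)).
    split; [apply le_div | apply div_le]; nra.
  - rewrite (pr_G1 _ _ _ _ _ P). unfold Rdiv. lra.
Qed.

End NormalizedProfile.

(** The quotient [G / U] is invariant under scaling, so only the other [U] is normalized by
    [U 0]. *)
Definition rhs (U G : R -> R) (y : R) : R := (y + G y / U y) / (2 - U y / U 0).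

(** The numerator lies between [(1 + 2 y) / 3] and [(1 + y) / 2], the denominator between [1 + y]
    and [1 + 2 y - y^2]. *)
Lemma rhs_bounds h I J U G :
  primitives h I J U G ->
  (forall y, 0 <= y <= 1 -> 1 / 3 <= h y <= 1 / 2) ->
  forall y, 0 <= y <= 1 -> 1 / 3 <= rhs U G y <= 1 / 2.
Proof.
  intros P Hh y Hy.
  pose proof (profile_quotient _ _ _ _ _ P Hh y Hy).
  pose proof (profile_lower _ _ _ _ _ P Hh y Hy).
  pose proof (profile_upper _ _ _ _ _ P Hh y Hy).
  unfold rhs. split; [apply le_div | apply div_le]; nra.
Qed.

(** * The contraction estimate *)

Section Contraction.

Variables h1 I1 J1 U1 G1 h2 I2 J2 U2 G2 : R -> R.
Variable e : R.
Hypothesis P1 : primitives h1 I1 J1 U1 G1.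
Hypothesis P2 : primitives h2 I2 J2 U2 G2.
Hypothesis B1 : forall y, 0 <= y <= 1 -> 1 / 3 <= h1 y <= 1 / 2.
Hypothesis B2 : forall y, 0 <= y <= 1 -> 1 / 3 <= h2 y <= 1 / 2.
Hypothesis h_close : forall y, 0 <= y <= 1 -> Rabs (h2 y - h1 y) <= e.

(** With [w = y (1 - y)^2], removing the common part [(1 - y)^2] of both profiles leaves differences
    bounded by [e w / 6] and, through the excess [v <= 3 w / 4], by [e w / 4]. Division by
    [U2 0 >= 1/9] gives [9 (1/6 + 1/4) = 15/4]. *)
Lemma profile_close y : 0 <= y <= 1 ->
  Rabs (U2 y / U2 0 - U1 y / U1 0) <= 15 / 4 * e * (y * (1 - y) ^ 2).
Proof.
  intros Hy.
  pose proof (profile_U0 _ _ _ _ _ P1 B1) as A1.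
  pose proof (profile_U0 _ _ _ _ _ P2 B2) as A2.
  pose proof (profile_lower _ _ _ _ _ P1 B1 y Hy) as L1.
  pose proof (profile_excess _ _ _ _ _ P1 B1 y Hy) as E1.
  destruct (primitives_compare _ _ _ _ _ _ _ _ _ _ e P1 P2) as [C0 C].
  { intros z Hz. specialize (h_close z Hz). apply Rabs_le_between in h_close. lra. }
  destruct (primitives_compare _ _ _ _ _ _ _ _ _ _ e P2 P1) as [D0 D].
  { intros z Hz. specialize (h_close z Hz). apply Rabs_le_between in h_close. lra. }
  specialize (C y Hy). specialize (D y Hy).
  set (w := y * (1 - y) ^ 2) in *.
  assert (Hw : 0 <= w) by (apply Rmult_le_pos; [lra | apply pow2_ge_0]).
  set (v := U1 y / U1 0 - (1 - y) ^ 2) in *.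
  assert (Hv : 0 <= v <= 3 / 4 * w) by (unfold v in *; lra).
  assert (He : 0 <= e) by lra.
  replace (U2 y / U2 0 - U1 y / U1 0) with
    (((U2 y - (1 - y) ^ 2 * U2 0 - (U1 y - (1 - y) ^ 2 * U1 0))
      - v * (U2 0 - U1 0)) / U2 0) by (unfold v; field; lra).
  assert (H3 : Rabs (v * (U2 0 - U1 0)) <= 3 / 4 * w * (e / 3)).
  { rewrite Rabs_mult. apply Rmult_le_compat; try apply Rabs_pos;
      apply Rabs_le_between; lra. }
  apply Rabs_le_between in H3. apply Rabs_le_between.
  assert (0 <= e * w) by (apply Rmult_le_pos; lra).
  split; [apply le_div | apply div_le]; nra.
Qed.

(** [profile_close] integrated from [y] to [1]: the integral of [z (1 - z)^2] is
    [(1 - y)^3 (1 + 3 y) / 12]. *)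
Lemma profile_integral_close y : 0 <= y <= 1 ->
  Rabs (G2 y / U2 0 - G1 y / U1 0)
    <= 15 / 4 * e * ((1 - y) ^ 3 * (1 + 3 * y) / 12).
Proof.
  intros Hy.
  pose proof (profile_U0 _ _ _ _ _ P1 B1) as A1.
  pose proof (profile_U0 _ _ _ _ _ P2 B2) as A2.
  (* The factor [s] treats both signs of the difference at once and avoids differentiating an
     absolute value. *)
  assert (Hs : forall s, -1 <= s <= 1 ->
    0 <= 15 / 4 * e * ((1 - y) ^ 3 * (1 + 3 * y) / 12)
         + s * (G2 y / U2 0 - G1 y / U1 0)).
  { intros s Hs.
    assert (E : 15 / 4 * e * ((1 - 1) ^ 3 * (1 + 3 * 1) / 12)
         + s * (G2 1 / U2 0 - G1 1 / U1 0) = 0).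
    { rewrite (pr_G1 _ _ _ _ _ P1), (pr_G1 _ _ _ _ _ P2). field. lra. }
    rewrite <- E at 1.
    apply (nonincreasing_of_derive
      (fun y => 15 / 4 * e * ((1 - y) ^ 3 * (1 + 3 * y) / 12)
                + s * (G2 y / U2 0 - G1 y / U1 0))
      (fun y => - (15 / 4 * e * (y * (1 - y) ^ 2)
                + s * (U2 y / U2 0 - U1 y / U1 0)))); [lra | |].
    - intros z _. pose proof (pr_G _ _ _ _ _ P1). derive_with P2.
      field. lra.
    - intros z Hz. pose proof (profile_close z ltac:(lra)) as H.
      assert (Rabs (s * (U2 z / U2 0 - U1 z / U1 0))
                <= 15 / 4 * e * (z * (1 - z) ^ 2)) as H'.
      { rewrite Rabs_mult.
        assert (Rabs s <= 1) by (apply Rabs_le_between; lra).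
        pose proof (Rabs_pos (U2 z / U2 0 - U1 z / U1 0)).
        pose proof (Rabs_pos s). nra. }
      apply Rabs_le_between in H'. lra. }
  pose proof (Hs 1 ltac:(lra)). pose proof (Hs (-1) ltac:(lra)).
  apply Rabs_le_between. lra.
Qed.

(** The difference is [(dG - (G1 / U1) dg) / g2]. Its numerator is of order [(1 - y)^3], which pays
    for the division by [g2 >= (1 - y)^2]. *)
Lemma quotient_close y : 0 <= y <= 1 ->
  Rabs (G2 y / U2 y - G1 y / U1 y)
    <= 15 / 4 * e * ((1 - y) * (1 + 9 * y) / 12).
Proof.
  intros [Hy0 [Hy1 | ->]].
  2: { rewrite (pr_G1 _ _ _ _ _ P1), (pr_G1 _ _ _ _ _ P2). unfold Rdiv.
       rewrite !Rmult_0_l, Rminus_0_r, Rabs_R0. lra. }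
  assert (Hy : 0 <= y <= 1) by lra.
  pose proof (profile_U0 _ _ _ _ _ P1 B1) as A1.
  pose proof (profile_U0 _ _ _ _ _ P2 B2) as A2.
  pose proof (profile_U_pos _ _ _ _ _ P1 B1 y ltac:(lra)) as V1.
  pose proof (profile_U_pos _ _ _ _ _ P2 B2 y ltac:(lra)) as V2.
  pose proof (profile_lower _ _ _ _ _ P2 B2 y Hy) as L2.
  pose proof (profile_quotient _ _ _ _ _ P1 B1 y Hy) as Q1.
  pose proof (profile_close y Hy) as Cg.
  pose proof (profile_integral_close y Hy) as CG.
  set (dg := U2 y / U2 0 - U1 y / U1 0) in *.
  set (dG := G2 y / U2 0 - G1 y / U1 0) in *.
  replace (G2 y / U2 y - G1 y / U1 y) with
    ((dG - G1 y / U1 y * dg) / (U2 y / U2 0))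
    by (unfold dg, dG; field; lra).
  assert (0 < (1 - y) ^ 2) by (apply pow_lt; lra).
  assert (H3 : Rabs (G1 y / U1 y * dg)
     <= (1 - y) / 2 * (15 / 4 * e * (y * (1 - y) ^ 2))).
  { rewrite Rabs_mult. apply Rmult_le_compat; try apply Rabs_pos; trivial.
    apply Rabs_le_between; lra. }
  set (b := 15 / 4 * e * ((1 - y) * (1 + 9 * y) / 12)).
  assert (Hb : Rabs (dG - G1 y / U1 y * dg) <= b * (1 - y) ^ 2).
  { unfold Rminus at 1. eapply Rle_trans; [apply Rabs_triang|].
    rewrite Rabs_Ropp.
    replace (b * (1 - y) ^ 2) with
      (15 / 4 * e * ((1 - y) ^ 3 * (1 + 3 * y) / 12)
       + (1 - y) / 2 * (15 / 4 * e * (y * (1 - y) ^ 2)))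
      by (unfold b; field).
    lra. }
  assert (0 <= b).
  { pose proof (Rabs_pos (dG - G1 y / U1 y * dg)). nra. }
  unfold Rdiv at 1. rewrite Rabs_mult, Rabs_inv, (Rabs_pos_eq (U2 y / U2 0)) by lra.
  apply div_le; [lra|]. nra.
Qed.

Lemma rhs_close y : 0 <= y <= 1 ->
  Rabs (rhs U2 G2 y - rhs U1 G1 y) <= 9 / 10 * e.
Proof.
  intros Hy.
  pose proof (rhs_bounds _ _ _ _ _ P1 B1 y Hy) as R1.
  pose proof (profile_upper _ _ _ _ _ P1 B1 y Hy) as M1.
  pose proof (profile_upper _ _ _ _ _ P2 B2 y Hy) as M2.
  pose proof (profile_close y Hy) as Cg.
  pose proof (quotient_close y Hy) as CQ.
  assert (He : 0 <= e) by (specialize (h_close y Hy);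
    pose proof (Rabs_pos (h2 y - h1 y)); lra).
  assert (E : rhs U2 G2 y - rhs U1 G1 y =
    ((G2 y / U2 y - G1 y / U1 y)
      + rhs U1 G1 y * (U2 y / U2 0 - U1 y / U1 0)) / (2 - U2 y / U2 0)).
  { unfold rhs.
    generalize (G2 y / U2 y) (G1 y / U1 y). intros q2 q1.
    revert M1 M2. generalize (U2 y / U2 0) (U1 y / U1 0). intros u2 u1 M1 M2.
    field. lra. }
  rewrite E. unfold Rdiv at 1.
  rewrite Rabs_mult, Rabs_inv, (Rabs_pos_eq (2 - _)) by lra.
  apply div_le; [lra|].
  assert (H3 : Rabs (rhs U1 G1 y * (U2 y / U2 0 - U1 y / U1 0))
     <= 1 / 2 * (15 / 4 * e * (y * (1 - y) ^ 2))).
  { rewrite Rabs_mult. apply Rmult_le_compat; try apply Rabs_pos; trivial.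
    apply Rabs_le_between; lra. }
  eapply Rle_trans; [apply Rabs_triang|].
  (* The factor [1 + y] is absorbed by the denominator, as [2 - g2 >= 1 + y]. *)
  apply Rle_trans with (9 / 10 * e * (1 + y)); [| nra].
  eapply Rle_trans; [apply Rplus_le_compat; [apply CQ | apply H3] |].
  enough (15 / 4 * ((1 - y) * (1 + 9 * y) / 12) + 1 / 2 * (15 / 4 * (y * (1 - y) ^ 2))
     <= 9 / 10 * (1 + y)) by nra.
  (* On [[0, 1]] the right side minus the left is a cubic with its minimum near [y = 0.3], which
     suggests these squares. *)
  pose proof (pow2_ge_0 (y - 3 / 10)).
  assert (0 <= (1 - y) * (y - 31 / 100) ^ 2)
    by (apply Rmult_le_pos; [lra | apply pow2_ge_0]).
  nra.
Qed.

End Contraction.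

(** * Fixed points of uniform contractions *)

(** Banach's theorem with the supremum distance expressed by pointwise bounds. Since this distance
    may be infinite, [M] bounds the first step of the iteration. *)
Lemma contraction_fixed_point (S : (R -> R) -> Prop) (Phi : (R -> R) -> R -> R)
    (q M : R) (h0 : R -> R) :
  0 <= q < 1 -> S h0 -> (forall h, S h -> S (Phi h)) ->
  (forall h1 h2 e, S h1 -> S h2 -> (forall y, Rabs (h2 y - h1 y) <= e) ->
     forall y, Rabs (Phi h2 y - Phi h1 y) <= q * e) ->
  (forall (u : nat -> R -> R) h, (forall n, S (u n)) ->
     (forall eps : posreal, exists n, forall y, Rabs (u n y - h y) <= eps) -> S h) ->
  (forall y, Rabs (Phi h0 y - h0 y) <= M) ->
  exists h, S h /\ forall y, Phi h y = h y.
Proof.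
  intros Hq S0 SPhi HPhi Sclosed HM.
  pose (u := fix u n := match n with O => h0 | Datatypes.S m => Phi (u m) end).
  assert (Su : forall n, S (u n)) by (induction n; simpl; auto).
  assert (Hstep : forall n y, Rabs (u (Datatypes.S n) y - u n y) <= M * q ^ n).
  { induction n; intros y.
    - simpl. rewrite Rmult_1_r. apply HM.
    - replace (M * q ^ Datatypes.S n) with (q * (M * q ^ n)) by (simpl; ring).
      apply (HPhi (u n) (u (Datatypes.S n))); auto. }
  assert (HM0 : 0 <= M) by (eapply Rle_trans; [apply Rabs_pos | apply (HM 0)]).
  (* [C * q ^ n] is the sum of the tail [M * q ^ k], [k >= n]. *)
  pose (C := M / (1 - q)).
  assert (HC : 0 <= C) by (apply Rdiv_le_0_compat; lra).
  assert (Hqn : forall n, 0 <= q ^ n) by (intros; apply pow_le; lra).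
  assert (Hdist : forall n k y, Rabs (u (n + k)%nat y - u n y) <= C * q ^ n).
  { intros n k y.
    (* The exact partial sum of the geometric series makes the induction on [k] go through. *)
    enough (Rabs (u (n + k)%nat y - u n y) <= C * q ^ n - C * q ^ (n + k)).
    { pose proof (Rmult_le_pos _ _ HC (Hqn (n + k)%nat)). lra. }
    induction k.
    - rewrite Nat.add_0_r, Rminus_eq_0, Rabs_R0. lra.
    - replace (n + Datatypes.S k)%nat with (Datatypes.S (n + k)) by lia.
      replace (u (Datatypes.S (n + k)) y - u n y) with
        (u (Datatypes.S (n + k)) y - u (n + k)%nat y + (u (n + k)%nat y - u n y))
        by ring.
      eapply Rle_trans; [apply Rabs_triang|].
      specialize (Hstep (n + k)%nat y).
      assert (M * q ^ (n + k) = C * q ^ (n + k) - C * q ^ Datatypes.S (n + k))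
        by (simpl; unfold C; field; lra).
      lra. }
  assert (Hgeom : is_lim_seq (fun n => C * q ^ n) 0).
  { evar_last; [apply is_lim_seq_scal_l, is_lim_seq_geom |].
    - rewrite Rabs_pos_eq; lra.
    - simpl. f_equal. ring. }
  assert (Hsmall : forall eps : posreal, exists N, forall n, (N <= n)%nat ->
             C * q ^ n < eps).
  { intros eps. apply is_lim_seq_spec in Hgeom.
    destruct (Hgeom eps) as [N HN]. exists N. intros n Hn.
    specialize (HN n Hn). apply Rabs_def2 in HN. lra. }
  assert (Hlim : forall y, ex_finite_lim_seq (fun n => u n y)).
  { intros y. apply ex_lim_seq_cauchy_corr. intros eps.
    destruct (Hsmall (pos_div_2 eps)) as [N HN]. exists N.
    specialize (HN N (Nat.le_refl N)). simpl in HN.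
    assert (H : forall n, (N <= n)%nat -> Rabs (u n y - u N y) < eps / 2).
    { intros n Hn. replace n with (N + (n - N))%nat by lia.
      eapply Rle_lt_trans; [apply Hdist | apply HN]. }
    intros n m Hn Hm. pose proof (H n Hn) as Hn'. pose proof (H m Hm) as Hm'.
    apply Rabs_def2 in Hn'. apply Rabs_def2 in Hm'. apply Rabs_def1; lra. }
  pose (h := fun y => real (Lim_seq (fun n => u n y))).
  assert (Hh : forall y, is_lim_seq (fun n => u n y) (h y))
    by (intros y; apply Lim_seq_correct', Hlim).
  assert (Huh : forall n y, Rabs (u n y - h y) <= C * q ^ n).
  { intros n y. rewrite Rabs_minus_sym.
    apply (is_lim_seq_le (fun k => Rabs (u (n + k)%nat y - u n y))
             (fun _ => C * q ^ n) (Rabs (h y - u n y)) (C * q ^ n)).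
    - intros k. apply Hdist.
    - apply (is_lim_seq_abs _ (Finite (h y - u n y))).
      apply is_lim_seq_minus'; [| apply is_lim_seq_const].
      apply (is_lim_seq_ext (fun k => u (k + n)%nat y)).
      + intros k. now rewrite Nat.add_comm.
      + now apply (is_lim_seq_incr_n (fun k => u k y) n).
    - apply is_lim_seq_const. }
  assert (Sh : S h).
  { apply (Sclosed u); trivial. intros eps.
    destruct (Hsmall eps) as [N HN]. exists N. intros y.
    specialize (HN N (Nat.le_refl N)). specialize (Huh N y). lra. }
  exists h. split; trivial. intros y.
  (* Both [Phi h] and [h] are within [q * (C * q ^ n)] of the iterate of index [n + 1]. *)
  assert (H : forall n, Rabs (Phi h y - h y) <= 2 * q * (C * q ^ n)).
  { intros n.
    assert (H1 : Rabs (Phi h y - Phi (u n) y) <= q * (C * q ^ n)).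
    { apply HPhi; trivial. intros z. rewrite Rabs_minus_sym. apply Huh. }
    pose proof (Huh (Datatypes.S n) y) as H2. simpl in H2.
    replace (Phi h y - h y) with
      (Phi h y - Phi (u n) y + (Phi (u n) y - h y)) by ring.
    eapply Rle_trans; [apply Rabs_triang|]. lra. }
  assert (H0 : Rabs (Phi h y - h y) <= 2 * q * 0).
  { apply (is_lim_seq_le (fun _ => Rabs (Phi h y - h y))
      (fun n => 2 * q * (C * q ^ n)) (Rabs (Phi h y - h y)) (2 * q * 0)); trivial.
    - apply is_lim_seq_const.
    - apply (is_lim_seq_scal_l (fun n => C * q ^ n) (2 * q) 0 Hgeom). }
  pose proof (Rabs_pos (Phi h y - h y)).
  assert (E : Rabs (Phi h y - h y) = 0) by lra.
  apply Rabs_eq_0 in E. lra.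
Qed.

(** * Primitives as integrals, and continuity of the map *)

Definition integral_from (a : R) (h : R -> R) (y : R) : R := RInt h a y.

Lemma is_derive_integral_from (a : R) (h : R -> R) :
  (forall y : R, continuous h y) -> forall y, is_derive (integral_from a h) y (h y).
Proof.
  intros Hh y. apply (is_derive_RInt h (integral_from a h) a); [| apply Hh].
  apply filter_forall. intros x.
  apply (RInt_correct h), (ex_RInt_continuous h). intros z _. apply Hh.
Qed.

Lemma continuous_of_derive (f df : R -> R) (y : R) :
  is_derive f y (df y) -> continuous f y.
Proof.
  intros H. apply (ex_derive_continuous f y). now exists (df y).
Qed.

Definition triple_integral (h : R -> R) : R -> R :=
  integral_from 1 (integral_from 1 (integral_from 0 h)).

Definition tail_integral (U : R -> R) (y : R) : R := - integral_from 1 U y.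

Lemma primitives_of_continuous (h : R -> R) :
  (forall y : R, continuous h y) ->
  primitives h (integral_from 0 h) (integral_from 1 (integral_from 0 h))
    (triple_integral h) (tail_integral (triple_integral h)).
Proof.
  intros Hh.
  pose proof (is_derive_integral_from 0 h Hh) as HI.
  pose proof (is_derive_integral_from 1 _
    (fun y => continuous_of_derive _ _ y (HI y))) as HJ.
  pose proof (is_derive_integral_from 1 _
    (fun y => continuous_of_derive _ _ y (HJ y))) as HU.
  pose proof (is_derive_integral_from 1 _
    (fun y => continuous_of_derive _ _ y (HU y))) as HG.
  split; trivial.
  - intros y. apply (is_derive_opp (integral_from 1 (triple_integral h))), HG.
  - apply (RInt_point 0 h).
  - apply (RInt_point 1 (integral_from 0 h)).
  - apply (RInt_point 1 (integral_from 1 (integral_from 0 h))).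
  - unfold tail_integral. unfold integral_from at 1.
    rewrite RInt_point. apply Ropp_0.
Qed.

(* Composing with [clamp] keeps every function continuous on the whole line. *)
Definition clamp (y : R) : R := Rmax 0 (Rmin y 1).

Lemma clamp_bounds y : 0 <= clamp y <= 1.
Proof.
  unfold clamp. pose proof (Rmin_r y 1). split; [apply Rmax_l|].
  apply Rmax_lub; lra.
Qed.

Lemma clamp_id y : 0 <= y <= 1 -> clamp y = y.
Proof.
  intros Hy. unfold clamp. rewrite Rmin_left, Rmax_right; lra.
Qed.

Lemma clamp_contracts x y : Rabs (clamp x - clamp y) <= Rabs (x - y).
Proof.
  unfold clamp, Rmin. destruct (Rle_dec x 1), (Rle_dec y 1); unfold Rmax;
    repeat destruct Rle_dec; unfold Rabs; repeat destruct Rcase_abs; lra.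
Qed.

Lemma continuous_clamp (y : R) : continuous clamp y.
Proof.
  apply filterlim_locally. intros eps. exists eps. intros x Hx.
  eapply Rle_lt_trans; [apply clamp_contracts | apply Hx].
Qed.

Lemma continuous_rhs_clamp h I J U G :
  primitives h I J U G ->
  (forall y, 0 <= y <= 1 -> 1 / 3 <= h y <= 1 / 2) ->
  forall y : R, continuous (fun y => rhs U G (clamp y)) y.
Proof.
  intros P Hh y. unfold rhs.
  pose proof (profile_U0 _ _ _ _ _ P Hh).
  pose proof (profile_upper _ _ _ _ _ P Hh _ (clamp_bounds y)).
  pose proof (clamp_bounds y).
  assert (CU : continuous (fun y => U (clamp y)) y).
  { apply (continuous_comp clamp U); [apply continuous_clamp|].
    apply (continuous_of_derive U J), P. }
  assert (CG : continuous (fun y => G (clamp y)) y).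
  { apply (continuous_comp clamp G); [apply continuous_clamp|].
    apply (continuous_of_derive G (fun y => - U y)), P. }
  assert (CQ : continuous (fun y => G (clamp y) / U (clamp y)) y).
  { destruct (Rlt_or_le (clamp y) 1) as [Hy | Hy].
    - pose proof (profile_U_pos _ _ _ _ _ P Hh (clamp y) ltac:(lra)).
      apply (continuous_mult (fun y => G (clamp y)) (fun y => / U (clamp y))); trivial.
      apply (continuous_comp (fun y => U (clamp y)) Rinv); trivial.
      apply continuous_Rinv. lra.
    - assert (E : clamp y = 1) by lra.
      apply filterlim_locally. intros eps. exists eps. intros x Hx.
      pose proof (profile_quotient _ _ _ _ _ P Hh _ (clamp_bounds x)).
      pose proof (clamp_bounds x).
      assert (Hc : Rabs (clamp x - clamp y) < eps)
        by (eapply Rle_lt_trans; [apply clamp_contracts | apply Hx]).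
      rewrite E in *. apply Rabs_def2 in Hc.
      change (Rabs (G (clamp x) / U (clamp x) - G 1 / U 1) < eps).
      rewrite (pr_G1 _ _ _ _ _ P). unfold Rdiv at 2. rewrite Rmult_0_l.
      apply Rabs_def1; lra. }
  apply (continuous_mult (fun y => clamp y + G (clamp y) / U (clamp y))
           (fun y => / (2 - U (clamp y) / U 0))).
  - apply (continuous_plus clamp); trivial. apply continuous_clamp.
  - apply (continuous_comp (fun y => 2 - U (clamp y) / U 0) Rinv).
    + apply (continuous_minus (fun _ => 2)); [apply continuous_const|].
      apply (continuous_mult (fun y => U (clamp y))); trivial.
      apply continuous_const.
    + apply continuous_Rinv. lra.
Qed.

(** * Existence of the fixed point *)

Definition step (h : R -> R) (y : R) : R :=
  rhs (triple_integral h) (tail_integral (triple_integral h)) (clamp y).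

(** The bounds hold on the whole line because the contraction principle measures distances there. *)
Definition admissible (h : R -> R) : Prop :=
  (forall y : R, continuous h y) /\ (forall y, 1 / 3 <= h y <= 1 / 2).

Lemma step_admissible h : admissible h -> admissible (step h).
Proof.
  intros [Ch Bh]. pose proof (primitives_of_continuous h Ch) as P. split.
  - exact (continuous_rhs_clamp _ _ _ _ _ P (fun y _ => Bh y)).
  - intros y. exact (rhs_bounds _ _ _ _ _ P (fun y _ => Bh y) _ (clamp_bounds y)).
Qed.

Lemma admissible_closed (u : nat -> R -> R) (h : R -> R) :
  (forall n, admissible (u n)) ->
  (forall eps : posreal, exists n, forall y, Rabs (u n y - h y) <= eps) ->
  admissible h.
Proof.
  intros Hu Hlim. split.
  - intros y. apply filterlim_locally. intros eps.
    assert (He : 0 < eps / 4) by (apply Rdiv_lt_0_compat; [apply cond_pos | lra]).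
    destruct (Hlim (mkposreal _ He)) as [n Hn]. simpl in Hn.
    destruct (Hu n) as [Cn _]. specialize (Cn y).
    apply filterlim_locally with (eps := mkposreal _ He) in Cn.
    revert Cn. apply filter_imp. intros x Hx.
    pose proof (Hn x) as Hnx. pose proof (Hn y) as Hny.
    change (Rabs (u n x - u n y) < eps / 4) in Hx.
    change (Rabs (h x - h y) < eps).
    apply Rabs_def2 in Hx. apply Rabs_le_between in Hnx. apply Rabs_le_between in Hny.
    apply Rabs_def1; lra.
  - intros y. split; apply Rnot_lt_le; intros Hy.
    + assert (He : 0 < (1 / 3 - h y) / 2) by lra.
      destruct (Hlim (mkposreal _ He)) as [n Hn]. specialize (Hn y). simpl in Hn.
      destruct (Hu n) as [_ Bn]. specialize (Bn y). apply Rabs_le_between in Hn. lra.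
    + assert (He : 0 < (h y - 1 / 2) / 2) by lra.
      destruct (Hlim (mkposreal _ He)) as [n Hn]. specialize (Hn y). simpl in Hn.
      destruct (Hu n) as [_ Bn]. specialize (Bn y). apply Rabs_le_between in Hn. lra.
Qed.

Lemma profile_exists : exists h I J U G,
  primitives h I J U G /\
  (forall y, 0 <= y <= 1 -> 1 / 3 <= h y <= 1 / 2) /\
  (forall y, 0 <= y <= 1 -> h y = rhs U G y).
Proof.
  assert (S0 : admissible (fun _ => 1 / 2)).
  { split; [intros y; apply continuous_const | intros; lra]. }
  (* [M = 1] suffices, since all values lie in [[1/3, 1/2]]. *)
  destruct (contraction_fixed_point admissible step (9 / 10) 1 (fun _ => 1 / 2))
    as (h & [Ch Bh] & Hh).
  - lra.
  - exact S0.
  - exact step_admissible.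
  - intros h1 h2 e [C1 B1] [C2 B2] He y.
    exact (rhs_close _ _ _ _ _ _ _ _ _ _ e
      (primitives_of_continuous h1 C1) (primitives_of_continuous h2 C2)
      (fun y _ => B1 y) (fun y _ => B2 y) (fun y _ => He y) _ (clamp_bounds y)).
  - exact admissible_closed.
  - intros y. destruct (step_admissible _ S0) as [_ B]. specialize (B y).
    apply Rabs_le_between. lra.
  - do 5 eexists. split; [exact (primitives_of_continuous h Ch)|]. split.
    + intros y _. apply Bh.
    + intros y Hy. rewrite <- (Hh y) at 1. unfold step. rewrite clamp_id; [reflexivity | exact Hy].
Qed.

(** * Derivatives of all orders away from the interface *)

(* The generators stand for [y], [I], [J], [U], [G], [1 / U], [1 / (2 - U / U 0)]. *)
Inductive generator := GY | GI | GJ | GU | GG | GInvU | GInv2.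

Inductive expr :=
  | Cst (c : R)
  | Gen (v : generator)
  | Add (e1 e2 : expr)
  | Mul (e1 e2 : expr).

Section Smoothness.

Variables h I J U G : R -> R.
Hypothesis P : primitives h I J U G.
Hypothesis h_bounds : forall y, 0 <= y <= 1 -> 1 / 3 <= h y <= 1 / 2.
Hypothesis h_eq : forall y, 0 <= y <= 1 -> h y = rhs U G y.

Let A_pos : 0 < U 0.
Proof. pose proof (profile_U0 _ _ _ _ _ P h_bounds). lra. Qed.

Definition eval_gen (v : generator) (y : R) : R :=
  match v with
  | GY => y
  | GI => I y
  | GJ => J y
  | GU => U y
  | GG => G y
  | GInvU => / U y
  | GInv2 => / (2 - U y / U 0)
  end.

Fixpoint eval (e : expr) (y : R) : R :=
  match e with
  | Cst c => c
  | Gen v => eval_gen v y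
  | Add e1 e2 => eval e1 y + eval e2 y
  | Mul e1 e2 => eval e1 y * eval e2 y
  end.

(** At [GI] the fixed-point equation replaces [h] by [rhs]; this closes the algebra under
    differentiation. *)
Definition diff_gen (v : generator) : expr :=
  match v with
  | GY => Cst 1
  | GI => Mul (Add (Gen GY) (Mul (Gen GG) (Gen GInvU))) (Gen GInv2)
  | GJ => Gen GI
  | GU => Gen GJ
  | GG => Mul (Cst (-1)) (Gen GU)
  | GInvU => Mul (Mul (Cst (-1)) (Gen GJ)) (Mul (Gen GInvU) (Gen GInvU))
  | GInv2 => Mul (Mul (Cst (/ U 0)) (Gen GJ)) (Mul (Gen GInv2) (Gen GInv2))
  end.

Fixpoint diff (e : expr) : expr :=
  match e with
  | Cst _ => Cst 0
  | Gen v => diff_gen v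
  | Add e1 e2 => Add (diff e1) (diff e2)
  | Mul e1 e2 => Add (Mul (diff e1) e2) (Mul e1 (diff e2))
  end.

(* The derivative is two-sided even at [y = 0], although [I' = h = rhs] only holds
   on the right of [0]. *)
Lemma is_derive_eval_gen v y :
  0 <= y < 1 -> is_derive (eval_gen v) y (eval (diff_gen v) y).
Proof.
  intros Hy.
  pose proof (profile_U_pos _ _ _ _ _ P h_bounds y Hy).
  pose proof (profile_upper _ _ _ _ _ P h_bounds y ltac:(lra)).
  pose proof (profile_lt2 _ _ _ _ _ P h_bounds y ltac:(lra)).
  destruct v; simpl.
  - apply @is_derive_id.
  - evar_last; [apply (pr_I _ _ _ _ _ P) | apply h_eq; lra].
  - apply (pr_J _ _ _ _ _ P).
  - apply (pr_U _ _ _ _ _ P).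
  - evar_last; [apply (pr_G _ _ _ _ _ P) | simpl; ring].
  - apply (is_derive_ext (fun y => / U y)); [reflexivity|].
    derive_with P; [lra | field; lra].
  - apply (is_derive_ext (fun y => / (2 - U y / U 0))); [reflexivity|].
    unfold Rdiv in *. derive_with P; [lra | field; lra].
Qed.

Lemma is_derive_eval e y :
  0 <= y < 1 -> is_derive (eval e) y (eval (diff e) y).
Proof.
  intros Hy. induction e; simpl.
  - apply @is_derive_const.
  - now apply is_derive_eval_gen.
  - now apply (is_derive_plus (eval e1) (eval e2)).
  - apply (is_derive_mult (eval e1) (eval e2)); trivial. apply Rmult_comm.
Qed.

(** * Scaling back to the free-boundary problem *)

Variable y0 : R.
Hypothesis y0_pos : 0 < y0.

Definition profile_expr : expr := Add (Cst 1) (Mul (Cst (- / U 0)) (Gen GU)).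

(** Differentiating syntactically gives all orders by one formula; the powers of [y0] come from the
    chain rule. *)
Definition solution_derivative (n : nat) (y : R) : R :=
  / y0 ^ n * eval (Nat.iter n diff profile_expr) (y / y0).

Let d := solution_derivative.

Lemma solution_0 y : d 0%nat y = 1 - U (y / y0) / U 0.
Proof. unfold d, solution_derivative; simpl. field. lra. Qed.

Lemma solution_1 y : d 1%nat y = - J (y / y0) / (U 0 * y0).
Proof. unfold d, solution_derivative; simpl. field. lra. Qed.

Lemma solution_2 y : d 2%nat y = - I (y / y0) / (U 0 * y0 ^ 2).
Proof. unfold d, solution_derivative; simpl. field. lra. Qed.

Lemma solution_3 y : d 3%nat y = - rhs U G (y / y0) / (U 0 * y0 ^ 3).
Proof.
  unfold d, solution_derivative, rhs; simpl.
  (* With the inverses as atoms, [field] does not ask that they be defined, so the identity holds at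
     every [y]. *)
  unfold Rdiv. generalize (/ (2 - U (y * / y0) * / U 0)) (/ U (y * / y0)).
  intros a b. field. lra.
Qed.

Lemma scaled_lt1 y : 0 <= y < y0 -> 0 <= y / y0 < 1.
Proof.
  intros Hy. split; [apply Rdiv_le_0_compat; lra|].
  apply Rlt_div_l; lra.
Qed.

Lemma is_derive_solution n y :
  0 <= y < y0 -> is_derive (d n) y (d (S n) y).
Proof.
  intros Hy. unfold d, solution_derivative.
  pose proof (is_derive_eval (Nat.iter n diff profile_expr) _ (scaled_lt1 y Hy)) as H.
  change (Nat.iter (S n) diff profile_expr) with (diff (Nat.iter n diff profile_expr)).
  revert H. generalize (Nat.iter n diff profile_expr). intros e H.
  evar_last.
  - apply (is_derive_scal (fun y => eval e (y / y0))).
    apply (is_derive_comp (eval e) (fun y => y / y0)); [exact H|].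
    auto_derive; [exact Logic.I | reflexivity].
  - unfold scal; simpl. unfold mult; simpl. field.
    split; [apply pow_nonzero; lra | lra].
Qed.

(** No inverse enters the orders [0] to [2], so here and in [is_derive_solution_1] the interface is
    included, as the [C^1] condition requires. *)
Lemma is_derive_solution_0 y : is_derive (d 0%nat) y (d 1%nat y).
Proof.
  apply (is_derive_ext (fun y => 1 - U (y / y0) / U 0)).
  { intros t. now rewrite solution_0. }
  rewrite solution_1. derive_with P. unfold Rdiv. field. lra.
Qed.

Lemma is_derive_solution_1 y : is_derive (d 1%nat) y (d 2%nat y).
Proof.
  apply (is_derive_ext (fun y => - J (y / y0) / (U 0 * y0))).
  { intros t. now rewrite solution_1. }
  rewrite solution_2. derive_with P. unfold Rdiv. field. lra.
Qed.

(** Strict signs come from [J x * (1 - x) <= - U x < 0] and, as [h >= 1/3], from [I x >= x / 3]. *)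
Lemma solution_signs y : 0 < y < y0 ->
  0 < d 0%nat y < 1 /\ 0 < d 1%nat y /\ d 2%nat y < 0.
Proof.
  intros Hy. rewrite solution_0, solution_1, solution_2.
  assert (0 < y / y0) by (apply Rdiv_lt_0_compat; lra).
  destruct (scaled_lt1 y ltac:(lra)) as [_ H1].
  revert H H1. generalize (y / y0). intros x Hx0 Hx1.
  assert (Hh : forall y, 0 <= y <= 1 -> 0 <= h y)
    by (intros z Hz; specialize (h_bounds z Hz); lra).
  pose proof (profile_U_pos _ _ _ _ _ P h_bounds x ltac:(lra)) as HU.
  pose proof (profile_upper _ _ _ _ _ P h_bounds x ltac:(lra)).
  pose proof (primitive_convex _ _ _ _ _ P Hh x ltac:(lra)).
  assert (HJ : 0 < - J x) by nra.
  assert (HI : I 0 - 0 / 3 <= I x - x / 3).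
  { apply (nondecreasing_of_derive (fun x => I x - x / 3) (fun x => h x - 1 / 3));
      [lra | |].
    - intros z _. derive_with P. field.
    - intros z Hz. specialize (h_bounds z ltac:(lra)). lra. }
  rewrite (pr_I0 _ _ _ _ _ P) in HI.
  assert (0 < U x / U 0) by (apply Rdiv_lt_0_compat; lra).
  split; [lra|]. split.
  - apply Rdiv_lt_0_compat; [lra|]. apply Rmult_lt_0_compat; lra.
  - assert (0 < I x / (U 0 * y0 ^ 2)).
    { apply Rdiv_lt_0_compat; [lra|].
      apply Rmult_lt_0_compat; [lra | apply pow_lt; lra]. }
    unfold Rdiv in *. lra.
Qed.

Definition flux_profile (y : R) : R :=
  - (y / y0 * U (y / y0) + G (y / y0)) / (U 0 ^ 2 * y0 ^ 3).

(* The singular factor [1 / (1 - f^2) = 1 / (g * (2 - g))] of [f'''] cancels. *)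
Lemma flux_solution y : 0 < y < y0 -> flux (d 0%nat) d y = flux_profile y.
Proof.
  intros Hy. unfold flux, flux_profile.
  destruct (solution_signs y Hy) as [H01 _].
  rewrite Rabs_pos_eq by nra.
  rewrite solution_3. rewrite solution_0 in *. unfold rhs.
  assert (Hx : 0 <= y / y0 < 1) by (apply scaled_lt1; lra).
  revert H01 Hx. generalize (y / y0). intros x H01 Hx.
  pose proof (profile_U_pos _ _ _ _ _ P h_bounds x Hx) as HU.
  pose proof (profile_lt2 _ _ _ _ _ P h_bounds x ltac:(lra)).
  field. lra.
Qed.

(** The terms in [U] cancel: [(y U + G)' = y J], which is a multiple of [y f']. *)
Lemma is_derive_flux_profile y :
  is_derive flux_profile y (- (y / y0 * J (y / y0)) / (U 0 ^ 2 * y0 ^ 4)).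
Proof.
  unfold flux_profile. derive_with P. unfold Rdiv. field. lra.
Qed.

Lemma D_in_of_derive (D : R -> Prop) (f df : R -> R) y :
  is_derive f y (df y) -> D_in f df D y.
Proof.
  intros H. apply is_derive_Reals, derivable_pt_lim_D_in in H.
  apply (limit1_imp _ (D_x no_cond y)); [| exact H].
  intros x [_ Hx]. split; [exact Logic.I | exact Hx].
Qed.

Lemma continue_in_of_derive (D : R -> Prop) (f df : R -> R) y :
  is_derive f y (df y) -> continue_in f D y.
Proof.
  intros H. eapply cont_deriv, D_in_of_derive, H.
Qed.

Lemma solution_solves : y0 ^ 4 = 4 / U 0 -> solves_fbp y0 (d 0%nat) d.
Proof.
  intros Hy0.
  assert (E1 : y0 / y0 = 1) by (field; lra).
  assert (E0 : 0 / y0 = 0) by (field; lra).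
  assert (Hflux1 : flux_profile y0 = 0).
  { unfold flux_profile. rewrite E1, (pr_U1 _ _ _ _ _ P), (pr_G1 _ _ _ _ _ P).
    field. lra. }
  split.
  - intros y _. split.
    + apply D_in_of_derive, is_derive_solution_0.
    + apply continue_in_of_derive with (d 2%nat), is_derive_solution_1.
  - split; [reflexivity|].
    intros n y (Hy & H1 & _). apply D_in_of_derive, is_derive_solution.
    (* The interface itself is degenerate, since the solution equals [1] there. *)
    split; [lra|]. destruct Hy as [_ [Hy | ->]]; trivial.
    exfalso. apply H1. rewrite solution_0, E1, (pr_U1 _ _ _ _ _ P). field. lra.
  - intros y Hy. eexists. split.
    + apply is_derive_Reals, (is_derive_ext_loc flux_profile); [| apply is_derive_flux_profile].
      apply (locally_interval _ y 0 y0); simpl; try lra.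
      intros z Hz1 Hz2. symmetry. apply flux_solution. lra.
    + rewrite solution_1, Hy0. field. lra.
  - rewrite solution_0, E0. field. lra.
  - rewrite solution_2, E0, (pr_I0 _ _ _ _ _ P). field. lra.
  - rewrite solution_0, E1, (pr_U1 _ _ _ _ _ P). field. lra.
  - rewrite solution_1, E1, (pr_J1 _ _ _ _ _ P). field. lra.
  - pose proof (continue_in_of_derive (fun y => 0 < y < y0) flux_profile
      (fun y => - (y / y0 * J (y / y0)) / (U 0 ^ 2 * y0 ^ 4)) y0
      (is_derive_flux_profile y0)) as H.
    unfold continue_in in H. rewrite Hflux1 in H.
    intros eps Heps. destruct (H eps Heps) as (alp & Halp & Hlim).
    exists alp. split; trivial. intros y [Hy Hd].
    rewrite (flux_solution y Hy). apply Hlim. split; trivial. split; trivial. lra.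
Qed.

End Smoothness.

Theorem proposition2p3 :
  exists (y0 : R) (f1 : R -> R) (d : nat -> R -> R),
    0 < y0 /\
    solves_fbp y0 f1 d /\
    (forall y, 0 < y < y0 -> 0 < d 1%nat y /\ d 2%nat y < 0) /\
    (forall y, 0 < y < y0 -> 0 < f1 y < 1).
Proof.
  destruct profile_exists as (h & I & J & U & G & P & Hb & Heq).
  pose proof (profile_U0 _ _ _ _ _ P Hb).
  (* The fourth root of [4 / U 0], so that [K = y0^4 / 4] equals [1 / U 0]. *)
  pose (y0 := sqrt (sqrt (4 / U 0))).
  assert (HA : 0 < 4 / U 0) by (apply Rdiv_lt_0_compat; lra).
  assert (Hy0 : 0 < y0) by (apply sqrt_lt_R0, sqrt_lt_R0, HA).
  assert (E : y0 ^ 4 = 4 / U 0).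
  { replace (y0 ^ 4) with ((y0 ^ 2) ^ 2) by ring.
    unfold y0. rewrite !pow2_sqrt; trivial; [lra | apply sqrt_pos]. }
  pose proof (solution_signs _ _ _ _ _ P Hb _ Hy0) as Hsigns.
  exists y0, (solution_derivative I J U G y0 0), (solution_derivative I J U G y0).
  split; [exact Hy0|]. split; [| split].
  - exact (solution_solves _ _ _ _ _ P Hb Heq _ Hy0 E).
  - intros y Hy. apply Hsigns, Hy.
  - intros y Hy. apply Hsigns, Hy.
Qed.
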